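(* Let $N$ be a functional satisfying $\mathsf{NIN}(N)$, i.e. for every $Y:[0,1]\to\mathbb{N}$ the output $N(Y)=(N(Y)(0),N(Y)(1))$ is a pair of reals in $[0,1]$ with $N(Y)(0)\neq N(Y)(1)$ and $Y(N(Y)(0))=Y(N(Y)(1))$. Then $N$ is not computable (in the sense of Kleene's S1-S9) from any type two functional $F:\mathbb{N}^{\mathbb{N}}\to\mathbb{N}$.
   Context: The metatheory is $\mathsf{ZFC}$. Let $\mathsf{Tp}[0]=\mathbb{N}$ and let $\mathsf{Tp}[k+1]$ be the set of all functions $\mathsf{Tp}[k]\to\mathbb{N}$. The relation $\{e\}(\Phi_0,\dots,\Phi_{n-1})=a$ (with $e,a\in\mathbb{N}$, $\Phi_i\in\mathsf{Tp}[k_i]$; $x,b,d\in\mathbb{N}$, $f\in\mathsf{Tp}[1]$) is the least relation closed under Kleene's schemes: S1: $\{\langle 1\rangle\}(x,\vec\Phi)=x+1$. S2: $\{\langle 2,q\rangle\}(\vec\Phi)=q$. S3: $\{\langle 3\rangle\}(x,\vec\Phi)=x$. S4: $\{\langle 4,e_0,e_1\rangle\}(\vec\Phi)=a$ if for some $b$, $\{e_1\}(\vec\Phi)=b$ and $\{e_0\}(b,\vec\Phi)=a$. S5: for $e=\langle 5,e_0,e_1\rangle$: $\{e\}(0,\vec\Phi)=a$ if $\{e_0\}(\vec\Phi)=a$; $\{e\}(x+1,\vec\Phi)=a$ if for some $b$, $\{e\}(x,\vec\Phi)=b$ and $\{e_1\}(b,\vec\Phi)=a$. S6: for a permutation $\pi$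 of $\{0,\dots,n-1\}$, $\{\langle 6,d,\pi(0),\dots,\pi(n-1)\rangle\}(\Phi_0,\dots,\Phi_{n-1})=a$ if $\{d\}(\Phi_{\pi(0)},\dots,\Phi_{\pi(n-1)})=a$. S7: $\{\langle 7\rangle\}(f,x,\vec\Phi)=f(x)$. S8: $\{\langle 8,d\rangle\}(\Phi^{k+2},\vec\Phi)=a$ if there is $\phi\in\mathsf{Tp}[k+1]$ with $\Phi(\phi)=a$ and $\{d\}(\Phi,\xi,\vec\Phi)=\phi(\xi)$ for all $\xi\in\mathsf{Tp}[k]$. S9: $\{\langle 9,m+1\rangle\}(d,\Phi_0,\dots,\Phi_n)=a$ if $m\le n$ and $\{d\}(\Phi_0,\dots,\Phi_m)=a$. A function $\phi:\mathsf{Tp}[k]\to\mathbb{N}$ is computable in $\vec\Phi$ if there is an index $e$ with $\{e\}(\xi,\vec\Phi)=\phi(\xi)$ for all $\xi\in\mathsf{Tp}[k]$. Objects of other finite types (functionals with reals, pairs or finite sequences as inputs or outputs) are handled via the usual codings and currying; reals are coded by fast-converging Cauchy sequences of rationals, i.e. by elements of $\mathbb{N}^{\mathbb{N}}$, and functions on $[0,1]$ respect equality of reals. Functionals $N$ that assign to every function $Y:[0,1]\to\mathbb{N}$ a pair $N(Y)=(N(Y)(0),N(Y)(1))$ of reals in $[0,1]$ are regarded as type 3 objects. *)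

(* Defs.v *)
From mathcomp Require Import all_boot all_order all_algebra all_fingroup.

Set Implicit Arguments.
Unset Strict Implicit.
Unset Printing Implicit Defensive.

Import Order.TTheory GRing.Theory Num.Theory.

Fixpoint Tp (k : nat) : Type := if k is k'.+1 then Tp k' -> nat else nat.

(* Argument lists mix types, so each argument carries its type level. *)
Definition obj : Type := {k : nat & Tp k}.

Definition mkobj (k : nat) (x : Tp k) : obj := existT Tp k x.

Notation "''o_' k x" := (mkobj (k := k) x)
  (at level 8, k at level 2, x at level 8, format "''o_' k  x").

Notation code := CodeSeq.code.

(* [kleene e Phi a] is {e}(Phi) = a; the sequence number <e0, ..., en> is
   [code [:: e0; ...; en]], and [code] is a bijection from seq nat to nat. *)
Inductive kleene : nat -> seq obj -> nat -> Prop :=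
| S1 (x : nat) (Phi : seq obj) :
    kleene (code [:: 1]) ('o_0 x :: Phi) x.+1
| S2 (q : nat) (Phi : seq obj) :
    kleene (code [:: 2; q]) Phi q
| S3 (x : nat) (Phi : seq obj) :
    kleene (code [:: 3]) ('o_0 x :: Phi) x
| S4 (e0 e1 a b : nat) (Phi : seq obj) :
    kleene e1 Phi b ->
    kleene e0 ('o_0 b :: Phi) a ->
    kleene (code [:: 4; e0; e1]) Phi a
| S5_0 (e0 e1 a : nat) (Phi : seq obj) :
    kleene e0 Phi a ->
    kleene (code [:: 5; e0; e1]) ('o_0 0 :: Phi) a
| S5_S (e0 e1 x a b : nat) (Phi : seq obj) :
    kleene (code [:: 5; e0; e1]) ('o_0 x :: Phi) b ->
    kleene e1 ('o_0 b :: Phi) a ->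
    kleene (code [:: 5; e0; e1]) ('o_0 x.+1 :: Phi) a
| S6 (n d a : nat) (pi : 'S_n) (Phi : 'I_n -> obj) :
    kleene d [seq Phi (pi i) | i <- enum 'I_n] a ->
    kleene (code [:: 6, d & [seq nat_of_ord (pi i) | i <- enum 'I_n]])
      [seq Phi i | i <- enum 'I_n] a
| S7 (f : Tp 1) (x : nat) (Phi : seq obj) :
    kleene (code [:: 7]) [:: 'o_1 f, 'o_0 x & Phi] (f x)
| S8 (d k a : nat) (H : Tp k.+2) (phi : Tp k.+1) (Phi : seq obj) :
    H phi = a ->
    (forall xi : Tp k, kleene d [:: 'o_(k.+2) H, 'o_k xi & Phi] (phi xi)) ->
    kleene (code [:: 8; d]) ('o_(k.+2) H :: Phi) a
| S9 (d m a : nat) (Phi : seq obj) :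
    m < size Phi ->
    kleene d (take m.+1 Phi) a ->
    kleene (code [:: 9; m.+1]) ('o_0 d :: Phi) a.

Local Open Scope ring_scope.

(* Every natural number decodes to a rational, and every rational has a code. *)
Definition rat_of_code (n : nat) : rat := odflt 0 (unpickle n).

Definition rseq (f : Tp 1) (n : nat) : rat := rat_of_code (f n).

Definition is_real (f : Tp 1) : Prop :=
  forall n i : nat, `|rseq f n - rseq f (n + i)| < 2 ^- n.

(* Two sequences with moduli 2^-n have the same limit (resp. ordered limits)
   exactly when their n-th terms agree (resp. are ordered) up to 2 * 2^-n. *)
Definition real_eq (f g : Tp 1) : Prop :=
  forall n : nat, `|rseq f n - rseq g n| <= 2 * 2 ^- n.

Definition real_le (f g : Tp 1) : Prop :=
  forall n : nat, rseq f n <= rseq g n + 2 * 2 ^- n.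

Definition real_of_rat (q : rat) : Tp 1 := fun _ => pickle q.

Record unit_real := UnitReal {
  ureal : Tp 1;
  _ : is_real ureal;
  _ : real_le (real_of_rat 0) ureal;
  _ : real_le ureal (real_of_rat 1) }.

(* A function [0,1] -> N is a type 2 object that respects equality of reals on
   codes of elements of [0,1]; its values elsewhere are unconstrained. *)
Record unit_fun := UnitFun {
  ufun : Tp 2;
  _ : forall x y : unit_real,
        real_eq (ureal x) (ureal y) -> ufun (ureal x) = ufun (ureal y) }.

Definition NIN (N : unit_fun -> unit_real * unit_real) : Prop :=
  forall Y : unit_fun,
    ~ real_eq (ureal (N Y).1) (ureal (N Y).2) /\
    ufun Y (ureal (N Y).1) = ufun Y (ureal (N Y).2).

(* N is curried to the number-valued (Y, i, n) |-> N(Y)(i)(n), the n-th entry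
   of the Cauchy sequence coding the real N(Y)(i), for i = 0, 1. *)
Definition NIN_value (N : unit_fun -> unit_real * unit_real)
    (Y : unit_fun) (i : bool) : Tp 1 :=
  ureal (if i then (N Y).2 else (N Y).1).

Definition computable_from (N : unit_fun -> unit_real * unit_real)
    (F : Tp 2) : Prop :=
  exists e : nat, forall (Y : unit_fun) (i : bool) (n : nat),
    kleene e [:: 'o_2 (ufun Y); 'o_0 (nat_of_bool i); 'o_0 n; 'o_2 F]
      (NIN_value N Y i n).

(* Main.v *)
From mathcomp Require Import all_boot all_order all_algebra all_fingroup.
From mathcomp Require Import archimedean boolp classical_sets.
Require Import Defs.

(**
Kleene computations in F and an oracle Y of type two, with numerical
arguments, make sense when Y is only a partial functional: scheme S8 then
requires the queried function to lie in the domain of Y. Such computations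
are monotone in Y. Call a partial Y honest when every value Y(f) = b is (the
code of) an index, with numerical parameters, for computing f, up to equality
of reals, from Y and F. By determinism, an honest Y separates distinct reals
of its domain. By Zorn's lemma there is a maximal honest Y; its domain
contains every function computable from Y and F, as otherwise Y could be
extended at such a function with its index as value. Hence every computation
from F and any total extension of this Y is already a computation from the
partial Y. If N were computable from F, both reals N(Y)(0) and N(Y)(1) would
therefore be in the domain of the partial Y, where Y cannot identify them.
*)

Set Implicit Arguments.
Unset Strict Implicit.
Unset Printing Implicit Defensive.

Import Order.TTheory GRing.Theory Num.Theory.

(** * Equality of coded reals *)

Section RealEquality.
Local Open Scope ring_scope.

Lemma real_eq_refl f : real_eq f f.
Proof. by move=> n; rewrite subrr normr0 mulr_ge0 ?invr_ge0 ?exprn_ge0. Qed.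

Lemma real_eq_sym f g : real_eq f g -> real_eq g f.
Proof. by move=> fg n; rewrite distrC. Qed.

Lemma exists_expr2V_le (e : rat) n :
  0 < e -> exists2 m, (n <= m)%N & 2 ^- m <= e.
Proof.
move=> e0; exists (maxn n (Num.bound e^-1)); first exact: leq_maxl.
rewrite -[leRHS]invrK lef_pV2 ?posrE ?invr_gt0 ?exprn_gt0 //.
exact/ltW/upper_nthrootP/leq_maxr.
Qed.

(** Passing through a late index [m] costs [2 ^- n] twice by the Cauchy moduli, and
    [4 * 2 ^- m <= e] for the two equalities, with [e] arbitrary. *)
Lemma real_eq_trans f g h :
  is_real f -> is_real h -> real_eq f g -> real_eq g h -> real_eq f h.
Proof.
move=> rf rh fg gh n; apply/ler_addgt0Pr => e e0.
have [|m lenm le_m] := @exists_expr2V_le (e / 4) n; first exact: divr_gt0.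
have := rf n (m - n)%N; have := rh n (m - n)%N; rewrite subnKC //.
have := fg m; have := gh m.
move: (rseq f n) (rseq f m) (rseq g m) (rseq h m) (rseq h n) => a b c d x.
rewrite ler_pdivlMr // in le_m.
move: (2 ^- m) (2 ^- n) le_m => p q pe cd bc xd ab.
have -> : a - x = (a - b) + (b - c) + (c - d) - (x - d).
  by rewrite opprB !addrA !subrK.
apply: (le_trans (ler_normB _ _)).
apply: (le_trans (lerD (ler_normD _ _) (lexx _))).
apply: (le_trans (lerD (lerD (ler_normD _ _) (lexx _)) (lexx _))).
have -> : 2 * q + e = q + e + q by rewrite mulrDl !mul1r addrAC.
apply: lerD (ltW xd).
apply: (le_trans (lerD (lerD (ltW ab) bc) cd)).
rewrite -addrA lerD2l; apply: le_trans pe.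
by rewrite -mulrDl -natrD mulrC.
Qed.

End RealEquality.

(* [real_eq] itself is transitive only on Cauchy sequences. *)
Definition same_real (f g : Tp 1) : Prop :=
  f = g \/ [/\ is_real f, is_real g & real_eq f g].

Lemma same_real_refl f : same_real f f.
Proof. by left. Qed.

Lemma same_real_sym f g : same_real f g -> same_real g f.
Proof.
by move=> [->|[rf rg fg]]; [left | right; split=> //; exact: real_eq_sym].
Qed.

Lemma same_real_trans f g h :
  same_real f g -> same_real g h -> same_real f h.
Proof.
move=> [->//|[rf rg fg]] [<-|[_ rh gh]]; right; split=> //.
exact: real_eq_trans fg gh.
Qed.

Lemma same_real_eq f g : same_real f g -> real_eq f g.
Proof. by move=> [->|[]//]; exact: real_eq_refl. Qed.

Lemma is_real_ureal (x : unit_real) : is_real (ureal x).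
Proof. by case: x. Qed.

Lemma same_real_ureal (x y : unit_real) :
  real_eq (ureal x) (ureal y) -> same_real (ureal x) (ureal y).
Proof. by move=> xy; right; split=> //; exact: is_real_ureal. Qed.

(* An argument of a computation: [inl n] is the number n, [inr false] the
   oracle Y and [inr true] the functional F. *)
Notation arg := (nat + bool)%type.

Local Open Scope classical_set_scope.

(** * Computations relative to a partial oracle *)

Section PartialOracle.
Variable F : Tp 2.

(* Indices are kept decoded, so that inversion reads off the scheme. The
   conditions on arguments that are not needed for determinism are dropped
   in S6 and S9. *)
Inductive pkleene (R : set (Tp 1 * nat)) : seq nat -> seq arg -> nat -> Prop :=
| PS1 x Psi : pkleene R [:: 1] (inl x :: Psi) x.+1
| PS2 q Psi : pkleene R [:: 2; q] Psi q
| PS3 x Psi : pkleene R [:: 3] (inl x :: Psi) x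
| PS4 e0 e1 a b Psi :
    pkleene R (CodeSeq.decode e1) Psi b ->
    pkleene R (CodeSeq.decode e0) (inl b :: Psi) a ->
    pkleene R [:: 4; e0; e1] Psi a
| PS5_0 e0 e1 a Psi :
    pkleene R (CodeSeq.decode e0) Psi a ->
    pkleene R [:: 5; e0; e1] (inl 0 :: Psi) a
| PS5_S e0 e1 x a b Psi :
    pkleene R [:: 5; e0; e1] (inl x :: Psi) b ->
    pkleene R (CodeSeq.decode e1) (inl b :: Psi) a ->
    pkleene R [:: 5; e0; e1] (inl x.+1 :: Psi) a
| PS6 d s a Psi :
    pkleene R (CodeSeq.decode d) [seq nth (inl 0) Psi i | i <- s] a ->
    pkleene R [:: 6, d & s] Psi a
| PS8_Y d a (phi : Tp 1) Psi :
    R (phi, a) ->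
    (forall xi,
       pkleene R (CodeSeq.decode d) [:: inr false, inl xi & Psi] (phi xi)) ->
    pkleene R [:: 8; d] (inr false :: Psi) a
| PS8_F d (phi : Tp 1) Psi :
    (forall xi,
       pkleene R (CodeSeq.decode d) [:: inr true, inl xi & Psi] (phi xi)) ->
    pkleene R [:: 8; d] (inr true :: Psi) (F phi)
| PS9 d m a Psi :
    pkleene R (CodeSeq.decode d) (take m.+1 Psi) a ->
    pkleene R [:: 9; m.+1] (inl d :: Psi) a.

Lemma pkleene_mono R R' e Psi a :
  R `<=` R' -> pkleene R e Psi a -> pkleene R' e Psi a.
Proof.
move=> RR'; elim=> {e Psi a}; by move=> *; econstructor; eauto.
Qed.

Definition functional (R : set (Tp 1 * nat)) : Prop :=
  forall f b c, R (f, b) -> R (f, c) -> b = c.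

(** At S8 the two queried functions agree pointwise by induction, so by extensionality the same
    query is made. *)
Lemma pkleene_det R e Psi a a' : functional R ->
  pkleene R e Psi a -> pkleene R e Psi a' -> a = a'.
Proof.
move=> fR K; elim: K a' => {e Psi a}.
- by move=> x Psi a' K; inversion K.
- by move=> q Psi a' K; inversion K.
- by move=> x Psi a' K; inversion K.
- move=> e0 e1 a b Psi _ IH1 _ IH0 a' K; inversion K; subst.
  by apply: IH0; rewrite (IH1 b0).
- by move=> e0 e1 a Psi _ IH a' K; inversion K; subst; exact: IH.
- move=> e0 e1 x a b Psi _ IH1 _ IH0 a' K; inversion K; subst.
  by apply: IH0; rewrite (IH1 b0).
- by move=> d s a Psi _ IH a' K; inversion K; subst; exact: IH.
- move=> d a phi Psi Rpa _ IH a' K; inversion K; subst.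
  by apply: fR Rpa _; suff -> : phi = phi0 by []; apply/funext => xi; exact: IH.
- move=> d phi Psi _ IH a' K; inversion K; subst.
  by congr F; apply/funext => xi; exact: IH.
- by move=> d m a Psi _ IH a' K; inversion K; subst; exact: IH.
Qed.

(* The index (e, Psi1, Psi2) stands for xi |-> {e}(Psi1, xi, Psi2). *)
Definition computes (R : set (Tp 1 * nat))
    (p : seq nat * seq arg * seq arg) (f : Tp 1) : Prop :=
  forall xi, pkleene R p.1.1 (p.1.2 ++ inl xi :: p.2) (f xi).

Lemma computes_mono R R' p f : R `<=` R' -> computes R p f -> computes R' p f.
Proof. by move=> RR' c xi; exact: pkleene_mono RR' _. Qed.

(** Saturation under equality of reals will let the total extension respect that equality; an index
    therefore computes only some representative [g] of [f]. *)
Definition honest (R : set (Tp 1 * nat)) : Prop :=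
  [/\ forall f g b, same_real f g -> R (f, b) -> R (g, b),
      functional R &
      forall f b, R (f, b) ->
        exists p g, [/\ b = pickle p, same_real g f & computes R p g]].

Lemma honest_inj R f g b :
  honest R -> R (f, b) -> R (g, b) -> same_real f g.
Proof.
move=> [_ fR cR] /cR [p [f' [-> ff' cf]]] /cR [q [g' [eqpq gg' cg]]].
have {eqpq} eqpq := pcan_inj pickleK eqpq; subst q.
have eqfg : f' = g' by apply/funext => xi; exact: pkleene_det (cf xi) (cg xi).
by apply: same_real_trans (same_real_sym ff') _; rewrite eqfg.
Qed.

Lemma honest_bigcup (C : set (set (Tp 1 * nat))) :
  C `<=` honest -> total_on C subset -> honest (\bigcup_(R in C) R).
Proof.
move=> hC tC; split.
- move=> f g b fg [R CR Rf]; exists R => //.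
  by case: (hC _ CR) => + _ _; apply; eauto.
- move=> f b c [R CR Rfb] [R' CR' Rfc].
  by case: (tC _ _ CR CR') => sub;
    [case: (hC _ CR') | case: (hC _ CR)] => _ + _; apply; eauto.
- move=> f b [R CR Rfb]; have [_ _ /(_ _ _ Rfb)[p [g [? ? c]]]] := hC _ CR.
  exists p, g; split=> //; apply: computes_mono c => x Rx.
  by exists R.
Qed.

Lemma honest_closed_exists : exists2 R, honest R &
  forall p f, computes R p f -> exists b, R (f, b).
Proof.
have [R [hR maxR]] := Zorn_bigcup honest_bigcup.
exists R => // p f cf; apply: contrapT => nR.
have [satR funR cR] := hR.
(* The new value goes to the whole class of [f], which keeps [R'] saturated. *)
pose R' : set (Tp 1 * nat) :=
  [set x | R x \/ same_real f x.1 /\ x.2 = pickle p].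
have RR' : R `<=` R' by move=> x; left.
apply: (maxR R'); first split=> //.
  move=> /(_ (f, pickle p)) R'R; apply: nR; exists (pickle p); apply: R'R.
  by right; split=> //; exact: same_real_refl.
(* By saturation this class misses the domain of [R], so old and new values cannot clash. *)
have newf g b : same_real f g -> ~ R (g, b).
  by move=> /same_real_sym fg Rg; apply: nR; exists b; exact: satR Rg.
split.
- move=> g h b gh [/(satR _ _ _ gh)|[/= fg bp]]; first by left.
  by right; split=> //; exact: same_real_trans gh.
- move=> g b c [Rb|[/= fg bp]] [Rc|[/= fg' cp]].
  + exact: funR Rb Rc.
  + by case: (newf _ _ fg' Rb).
  + by case: (newf _ _ fg Rc).
  + by rewrite bp cp.
- move=> g b [/cR[q [h [? ? c]]]|[/= fg bp]].
    by exists q, h; split=> //; exact: computes_mono c.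
  by exists p, f; split=> //; exact: computes_mono cf.
Qed.

(** * From a total extension back to the partial oracle *)

Section TotalExtension.
Variables (R : set (Tp 1 * nat)) (Y : Tp 2).
Hypothesis YR : forall f b, R (f, b) -> Y f = b.
Hypothesis closedR : forall p f, computes R p f -> exists b, R (f, b).

Definition interp (c : arg) : obj :=
  match c with
  | inl n => 'o_0 n
  | inr false => 'o_2 Y
  | inr true => 'o_2 F
  end.

(* Partial projections from [obj], so that equal packed objects have equal
   contents without any axiom on equality proofs. *)
Definition obj_level (o : obj) : nat := projT1 o.

Definition obj_nat (o : obj) : option nat :=
  match o with existT k x => (if k is 0 return Tp k -> option nat
    then fun n => Some n else fun=> None) x end.

Definition obj_tp2 (o : obj) : option (Tp 2) :=
  match o with existT k x => (if k is 2 return Tp k -> option (Tp 2)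
    then fun H => Some H else fun=> None) x end.

Lemma interp_nat n c : 'o_0 n = interp c -> c = inl n.
Proof. by case: c => [m|[]] /(congr1 obj_nat)//= [->]. Qed.

Lemma interp_tp2 H c : 'o_2 H = interp c ->
  (c = inr false /\ H = Y) \/ (c = inr true /\ H = F).
Proof. by case: c => [m|[]] /(congr1 obj_tp2)//= [->]; [right|left]. Qed.

Lemma interp_tp1 f c : 'o_1 f <> interp c.
Proof. by case: c => [m|[]] /(congr1 obj_level). Qed.

Lemma interp_tp3 k (H : Tp k.+3) c : 'o_(k.+3) H <> interp c.
Proof. by case: c => [m|[]] /(congr1 obj_level). Qed.

Lemma kleene_pkleene e Phi a : kleene e Phi a ->
  forall Psi, Phi = map interp Psi -> pkleene R (CodeSeq.decode e) Psi a.
Proof.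
elim=> {e Phi a}.
- move=> x Phi Psi; rewrite CodeSeq.codeK.
  by case: Psi => [|c Psi]//= [/interp_nat -> _]; exact: PS1.
- by move=> q Phi Psi _; rewrite CodeSeq.codeK; exact: PS2.
- move=> x Phi Psi; rewrite CodeSeq.codeK.
  by case: Psi => [|c Psi]//= [/interp_nat -> _]; exact: PS3.
- move=> e0 e1 a b Phi _ IH1 _ IH0 Psi E; rewrite CodeSeq.codeK.
  by apply: PS4 (IH1 _ E) _; apply: IH0; rewrite /= E.
- move=> e0 e1 a Phi _ IH Psi; rewrite CodeSeq.codeK.
  by case: Psi => [|c Psi]//= [/interp_nat -> E]; apply: PS5_0; exact: IH.
- move=> e0 e1 x a b Phi _ + _ IH0 Psi; rewrite CodeSeq.codeK => IH1.
  case: Psi => [|c Psi]//= [/interp_nat -> E].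
  apply: PS5_S (IH1 (inl x :: Psi) _) _; first by rewrite /= E.
  by apply: IH0; rewrite /= E.
- move=> n d a pi Phi _ IH Psi E; rewrite CodeSeq.codeK.
  apply: PS6; apply: IH; rewrite -!map_comp; apply: eq_map => i /=.
  have ltn : pi i < size Psi.
    by rewrite -(size_map interp) -E size_map size_enum_ord.
  rewrite -(nth_map _ ('o_0 0)) // -E (nth_map (pi i)) ?size_enum_ord //.
  by rewrite nth_ord_enum.
(* S7 cannot occur, since [Psi] has no entries of type one. *)
- by move=> f x Phi [|c Psi] // [/interp_tp1].
- move=> d [|k] a H phi Phi Ha _ IH [|c Psi] // [+ E]; last first.
    by move/interp_tp3.
  rewrite CodeSeq.codeK => Hc.
  have {}IH xi : pkleene R (CodeSeq.decode d) [:: c, inl xi & Psi] (phi xi).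
    by apply: IH; rewrite /= E Hc.
  have [[ec eH]|[ec eH]] := interp_tp2 Hc; subst c H; last first.
    by rewrite -Ha; exact: PS8_F IH.
  (* Closure puts the query [phi] in the domain of [R], so the answer of [Y] is one of [R]. *)
  have [b Rb] := @closedR (CodeSeq.decode d, [:: inr false], Psi) phi IH.
  by apply: PS8_Y IH; rewrite -Ha (YR Rb).
- move=> d m a Phi _ _ IH Psi; rewrite CodeSeq.codeK.
  case: Psi => [|c Psi]//= [/interp_nat -> E].
  by apply: PS9; apply: IH; rewrite map_take E.
Qed.

End TotalExtension.
End PartialOracle.

Theorem theorem4p1 (N : unit_fun -> unit_real * unit_real) (hN : NIN N)
    (F : Tp 2) : ~ computable_from N F.
Proof.
have [R hR closedR] := honest_closed_exists F.
have [satR funR _] := hR.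
pose Y : Tp 2 := fun f => xget 0 [set b | R (f, b)].
have YR f b : R (f, b) -> Y f = b.
  by move=> Rb; apply: xget_unique => // c Rc; exact: funR Rc Rb.
have Yext (x y : unit_real) :
    real_eq (ureal x) (ureal y) -> Y (ureal x) = Y (ureal y).
  (* Equal reals have the same set of values in [R], so [xget] chooses alike, also when that set is
     empty. *)
  move=> /same_real_ureal xy; congr xget; apply/seteqP.
  by split=> b /=; apply: satR => //; exact: same_real_sym.
pose U := UnitFun Yext.
move=> [e comp_e].
have domN i : exists b, R (NIN_value N U i, b).
  pose p : seq nat * seq arg * seq arg :=
    (CodeSeq.decode e, [:: inr false; inl (nat_of_bool i)], [:: inr true]).
  apply: (closedR p) => n.
  exact: (kleene_pkleene YR closedR (comp_e U i n)
    (Psi := p.1.2 ++ inl n :: p.2)).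
have [neqN eqN] := hN U.
have [b0 R0] := domN false; have [b1 R1] := domN true.
apply/neqN/same_real_eq/(honest_inj hR R0); rewrite -(YR _ _ R0).
by rewrite /= /NIN_value /= in eqN *; rewrite eqN (YR _ _ R1).
Qed.
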